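(* Let $n\geq 2$ be an integer. If $x\in\mathbb R^n$ and $\operatorname{rank}(G_x)=1$, then $\operatorname{orb}(x)=\{x'\in\mathbb R^n\mid G_{x'}=G_x\}$.
   Context: $\mathcal G_n=GL(n,\mathbb Z)\ltimes\mathbb Z^n$ is the group of affine transformations of $\mathbb R^n$ of the form $x\mapsto Ux+t$, where $t\in\mathbb Z^n$ and $U$ is an integer $n\times n$ matrix with $\det(U)=\pm1$. For $x\in\mathbb R^n$, $\operatorname{orb}(x)=\{y\in\mathbb R^n\mid y=\gamma(x)\text{ for some }\gamma\in\mathcal G_n\}$. For $x=(x_1,\ldots,x_n)\in\mathbb R^n$, $G_x=\mathbb Z+\mathbb Zx_1+\cdots+\mathbb Zx_n$ is the subgroup of the additive group $\mathbb R$ generated by $1,x_1,\ldots,x_n$, and $\operatorname{rank}(G_x)$ is its rank as a free abelian group. Equality $G_{x'}=G_x$ means equality as subsets of $\mathbb R$. *)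

(* Defs.v *)
(* The real line is an arbitrary [R : realType]; points of R^n are column
   vectors. *)
From HB Require Import structures.
From mathcomp Require Import all_boot all_order all_algebra.
From mathcomp Require Import boolp classical_sets reals.

Set Implicit Arguments.
Unset Strict Implicit.
Unset Printing Implicit Defensive.

Import GRing.Theory.

Local Open Scope classical_set_scope.
Local Open Scope ring_scope.

Definition integral_affine (R : realType) (n : nat)
    (U : 'M[int]_n) (t : 'cV[int]_n) (x : 'cV[R]_n) : 'cV[R]_n :=
  map_mx intr U *m x + map_mx intr t.

(* GL(n, Z) \ltimes Z^n, through its action on R^n *)
Definition affine_group (R : realType) (n : nat) :
    set ('cV[R]_n -> 'cV[R]_n) :=
  [set g | exists (U : 'M[int]_n) (t : 'cV[int]_n),
     (\det U = 1 \/ \det U = -1) /\ g = integral_affine U t].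

Definition orb (R : realType) (n : nat) (x : 'cV[R]_n) : set 'cV[R]_n :=
  [set y | exists g, affine_group g /\ y = g x].

(* Z + Z x_1 + ... + Z x_n *)
Definition coord_group (R : realType) (n : nat) (x : 'cV[R]_n) : set R :=
  [set s | exists (a : int) (c : 'I_n -> int),
     s = a%:~R + \sum_(i < n) x i 0 *~ c i].

(* The subgroup G of V is free abelian of rank r: it has a Z-basis with r
   elements. *)
Definition free_abelian_of_rank (V : zmodType) (G : set V) (r : nat) : Prop :=
  exists b : 'I_r -> V,
    G = [set v | exists c : 'I_r -> int, v = \sum_(i < r) b i *~ c i] /\
    (forall c : 'I_r -> int,
       \sum_(i < r) b i *~ c i = 0 -> forall i, c i = 0).

(* Main.v *)
Require Import Defs.
From HB Require Import structures.
From mathcomp Require Import all_boot all_order all_algebra.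
From mathcomp Require Import boolp classical_sets reals.
From mathcomp Require Import ring.

Set Implicit Arguments.
Unset Strict Implicit.
Unset Printing Implicit Defensive.

Import GRing.Theory.

Local Open Scope classical_set_scope.
Local Open Scope ring_scope.

(** The group [coord_group x] only depends on the orbit of [x], because the
    coordinates of [U x + t] are integral combinations of [1] and of the
    coordinates of [x], and [U] is invertible over the integers
    ([coord_group_orb]).

    Conversely, suppose that the group has rank one, with generator [g].  As it
    contains [1] and the coordinates of [x], there are an integer [d] and an
    integral vector [p] with [1 = d g] and [x = g p]; as it contains [g], the
    entries of [p] and [d] are together coprime.  It suffices to move every such
    [x] to the point [g e_0], which is determined by the group alone
    ([orb_generator]).  In terms of [p] one may apply GL(n, Z) and add multiples
    of [d].  The Smith normal form of a column moves [p] to [h e_0], where [h]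
    is coprime to [d].  Since there is a second coordinate, a translation gives
    [h e_0 + d e_1], a primitive vector, and a second application of the Smith
    normal form moves it to [e_0] ([unimodular_mod_reduction]). *)

(** * The affine group over the integers *)

Lemma det_unitmxP n (U : 'M[int]_n) :
  (\det U = 1 \/ \det U = -1) <-> U \in unitmx.
Proof.
rewrite unitmxE; split; first by case=> ->.
by case/orP=> /eqP ->; [left | right].
Qed.

Lemma orbP (R : realType) n (x y : 'cV[R]_n) :
  orb x y <->
  exists (U : 'M[int]_n) (t : 'cV[int]_n),
    U \in unitmx /\ y = integral_affine U t x.
Proof.
split.
  by case=> _ [[U [t [/det_unitmxP uU ->]]] ->]; exists U, t.
case=> U [t [/det_unitmxP dU ->]].
by exists (integral_affine U t); split=> //; exists U, t.
Qed.

Lemma integral_affine_comp (R : realType) n (U V : 'M[int]_n)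
    (s t : 'cV[int]_n) (x : 'cV[R]_n) :
  integral_affine U s (integral_affine V t x) =
  integral_affine (U *m V) (U *m t + s) x.
Proof.
by rewrite /integral_affine map_mxD !map_mxM mulmxDr mulmxA addrA.
Qed.

Lemma integral_affine1 (R : realType) n (x : 'cV[R]_n) :
  integral_affine 1%:M 0 x = x.
Proof. by rewrite /integral_affine map_mx1 map_mx0 mul1mx addr0. Qed.

Lemma orb_sym (R : realType) n (x y : 'cV[R]_n) : orb x y -> orb y x.
Proof.
move=> /orbP[U [t [uU ->]]]; apply/orbP.
exists (invmx U), (- (invmx U *m t)); rewrite unitmx_inv; split=> //.
by rewrite integral_affine_comp mulVmx // subrr integral_affine1.
Qed.

Lemma orb_trans (R : realType) n (x y z : 'cV[R]_n) :
  orb x y -> orb y z -> orb x z.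
Proof.
move=> /orbP[U [t [uU ->]]] /orbP[V [s [uV ->]]]; apply/orbP.
exists (V *m U), (V *m t + s).
by rewrite unitmx_mul uU uV integral_affine_comp.
Qed.

(** * Invariance of the coordinate group *)

Lemma coord_groupP (R : realType) n (x : 'cV[R]_n) s :
  coord_group x s <->
  exists (a : int) (c : 'rV[int]_n),
    s = a%:~R + (map_mx intr c *m x) 0 0.
Proof.
split=> -[a [c ->]].
  exists a, (\row_i c i); congr (_ + _); rewrite mxE.
  by apply: eq_bigr => i _; rewrite !mxE mulrzl.
exists a, (c 0); congr (_ + _); rewrite mxE.
by apply: eq_bigr => i _; rewrite !mxE mulrzl.
Qed.

Lemma sub_coord_group_affine (R : realType) n (U : 'M[int]_n)
    (t : 'cV[int]_n) (x : 'cV[R]_n) :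
  coord_group (integral_affine U t x) `<=` coord_group x.
Proof.
move=> _ /coord_groupP[a [c ->]]; apply/coord_groupP.
exists (a + (c *m t) 0 0), (c *m U).
rewrite /integral_affine mulmxDr mulmxA -!map_mxM.
by rewrite [X in _ + X]mxE [X in _ + (_ + X)]mxE intrD -addrA [X in _ + X]addrC.
Qed.

Lemma coord_group_orb (R : realType) n (x y : 'cV[R]_n) :
  orb x y -> coord_group y = coord_group x.
Proof.
move=> xy; apply/seteqP; split.
  by case/orbP: xy => U [t [_ ->]]; exact: sub_coord_group_affine.
by case/orbP: (orb_sym xy) => U [t [_ ->]]; exact: sub_coord_group_affine.
Qed.

(** * Reduction of integral columns *)

(** For a one-column matrix, the right factor in the Smith normal form is a
    scalar and can be absorbed into the only invariant factor. *)
Lemma column_reduction n (p : 'cV[int]_n.+1) :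
  exists (L : 'M[int]_n.+1) (h : int),
    L \in unitmx /\ p = L *m (h *: delta_mx 0 0).
Proof.
have [L uL [Q _ [d _ ->]]] := int_Smith_normal_form p.
exists L, (d`_0 * Q 0 0); split=> //.
rewrite -mulmxA; congr (_ *m _); apply/colP=> i.
rewrite !mxE big_ord1 !mxE eqxx andbT.
case: (eqVneq i 0) => [-> | i0] /=; first by rewrite mulr1.
have -> : (i == 0%N :> nat) = false by apply/negbTE.
by rewrite mulr0n mul0r mulr0.
Qed.

(** Transitivity of the integral linear group on the columns that are unimodular
    modulo [d].  Once [p] is reduced to [h e_0], adding [d e_1] produces a column
    whose entries have gcd 1, so that its reduced form [k e_0] has [k] a unit. *)
Lemma unimodular_mod_reduction n (p : 'cV[int]_n.+2) (d a : int)
    (c : 'rV[int]_n.+2) :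
  a * d + (c *m p) 0 0 = 1 ->
  exists (U : 'M[int]_n.+2) (t : 'cV[int]_n.+2),
    U \in unitmx /\ U *m p + d *: t = delta_mx 0 0.
Proof.
have [L [h [uL ->]]] := column_reduction p.
pose e1 : 'cV[int]_n.+2 := delta_mx 1 0.
have [M [k [uM hM]]] := column_reduction (h *: delta_mx 0 0 + d *: e1).
move=> bez.
(* Reading [hM] in the rows 0 and 1 shows that [k] divides both [h] and [d]. *)
have hk : h = k * M 0 0.
  move/matrixP: (hM) => /(_ 0 0).
  by rewrite -scalemxAr -colE !mxE /= mulr1 mulr0 addr0.
have dk : d = k * M 1 0.
  move/matrixP: (hM) => /(_ 1 0).
  by rewrite -scalemxAr -colE !mxE /= mulr1 mulr0 add0r.
have kM : k * (a * M 1 0 + (c *m L) 0 0 * M 0 0) = 1.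
  have cLe : (c *m (L *m (h *: delta_mx 0 0 : 'cV_n.+2))) 0 0 = h * (c *m L) 0 0.
    by rewrite mulmxA -scalemxAr -colE mxE [X in _ * X]mxE.
  by rewrite -[RHS]bez cLe hk dk; ring.
have uk : k \is a GRing.unit.
  by apply/unitrPr; eexists; exact: kM.
exists (k^-1 *: (invmx M *m invmx L)), (k^-1 *: (invmx M *m e1)); split.
  by rewrite unitmxZ ?unitrV // unitmx_mul !unitmx_inv uM.
rewrite -scalemxAl mulmxA mulmxKV // scalerA (mulrC d) -scalerA.
rewrite [d *: _]scalemxAr -scalerDr -mulmxDr hM mulKmx // scalerA.
by rewrite mulVr // scale1r.
Qed.

(** * Rank one *)

Lemma rank1_generator (V : zmodType) (G : set V) :
  free_abelian_of_rank G 1 ->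
  exists g : V, g != 0 /\ G = [set v | exists m : int, v = g *~ m].
Proof.
case=> b [-> free]; exists (b 0); split.
  apply/eqP=> b0; have := free (fun=> 1).
  by rewrite big_ord1 b0 mul0rz => /(_ erefl 0).
apply/seteqP; split=> v [m ->]; first by exists (m 0); rewrite big_ord1.
by exists (fun=> m); rewrite big_ord1.
Qed.

(** The orbit contains a point that depends only on a generator of the
    coordinate group. *)
Lemma orb_generator (R : realType) n (x : 'cV[R]_n.+2) (g : R) :
  g != 0 -> coord_group x = [set v | exists m : int, v = g *~ m] ->
  orb x (g *: delta_mx 0 0).
Proof.
move=> g0 Gx.
have [d d1] : exists d : int, 1 = g *~ d.
  have : coord_group x 1; last by rewrite Gx.
  by apply/coord_groupP; exists 1, 0; rewrite map_mx0 mul0mx mxE addr0.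
have /choice[p xp] : forall i, exists m : int, x i 0 = g *~ m.
  move=> i; have : coord_group x (x i 0); last by rewrite Gx.
  apply/coord_groupP; exists 0, (delta_mx 0 i).
  by rewrite map_delta_mx -rowE mxE add0r.
have xE : x = g *: map_mx intr (\col_i p i).
  by apply/colP=> i; rewrite !mxE xp mulrzr.
have affineE U t : integral_affine U t x =
    g *: map_mx intr (U *m (\col_i p i) + d *: t).
  rewrite /integral_affine xE -scalemxAr map_mxD map_mxM map_mxZ scalerDr.
  by rewrite scalerA mulrzr -d1 scale1r.
have [a [c gac]] : exists (a : int) (c : 'rV[int]_n.+2),
    g = a%:~R + (map_mx intr c *m x) 0 0.
  by apply/coord_groupP; rewrite Gx; exists 1.
have bez : a * d + (c *m (\col_i p i)) 0 0 = 1.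
  apply: (@intr_inj R); apply: (mulfI g0).
  rewrite mulr1 [RHS]gac xE -scalemxAr -map_mxM !mxE intrD intrM mulrDr.
  by rewrite mulrCA mulrzr -d1 mulr1.
have [U [t [uU Ut]]] := unimodular_mod_reduction bez.
by apply/orbP; exists U, t; rewrite affineE Ut map_delta_mx.
Qed.

Theorem mainTheorem3 (R : realType) (n : nat) (hn : (2 <= n)%N)
    (x : 'cV[R]_n) (hrank : free_abelian_of_rank (coord_group x) 1) :
  orb x = [set x' : 'cV[R]_n | coord_group x' = coord_group x].
Proof.
case: n hn x hrank => [|[|n]] // _ x /rank1_generator[g [g0 Gx]].
apply/seteqP; split=> [y xy | y /= yx]; first exact: coord_group_orb.
apply: orb_trans (orb_generator g0 Gx) _.
by apply/orb_sym/orb_generator; rewrite // yx.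
Qed.
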